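(* Let $p$ be an odd prime and let $G$ be the GGS-group defined by a vector $\mathbf{e}=(e_1,\dots,e_{p-1})\in\mathbb{F}_p^{p-1}$ satisfying property TF. Then the derived subgroup $G'$ is torsion-free.
   Context: Fix an odd prime $p$. Let $X=\{1,\dots,p\}$ and let $T$ be the regular rooted tree whose vertices are the words in the free monoid $X^*$, with $u,v$ joined by an edge if $v=ux$ or $u=vx$ for some $x\in X$. $\operatorname{Aut} T$ is the group of automorphisms of $T$ and $\operatorname{st}(1)$ is the stabilizer of all vertices of length $1$. For $g$ fixing a vertex $v$, $g_v\in\operatorname{Aut}T$ denotes the restriction of $g$ to the subtree rooted at $v$ (identified with $T$), i.e. $g(vw)=v\,g_v(w)$; $\psi:\operatorname{st}(1)\to \operatorname{Aut}T\times\overset{p}{\cdots}\times\operatorname{Aut}T$ is the isomorphism $g\mapsto(g_1,\dots,g_p)$. For a non-zero vector $\mathbf{e}=(e_1,\dots,e_{p-1})\in\mathbb{F}_p^{p-1}$, the GGS-group with defining vector $\mathbf{e}$ is $G=\langle a,b\rangle\le\operatorname{Aut}T$, where $a$ is the rooted automorphism given by $a(xv)=\sigma(x)v$ for $x\in X$, $v\in X^*$, with $\sigma=(1\;2\;\dots\;p)$, and $b\in\operatorname{st}(1)$ is recursively defined by $\psi(b)=(a^{e_1},a^{e_2},\dots,a^{e_{p-1}},b)$. Property TF: given $\mathbf{e}=(e_1,\dots,e_{p-1})\in\mathbb{F}_p^{p-1}$, let $C$ be the $p\times p$ circulant matrix over $\mathbb{F}_p$ $$C=\begin{pmatrix}0&e_1&\cdots&e_{p-1}\\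 e_{p-1}&0&\cdots&e_{p-2}\\ \vdots&\vdots&\ddots&\vdots\\ e_1&e_2&\cdots&0\end{pmatrix}$$ (each row is the previous one shifted cyclically one place to the right). For $(i_1,\dots,i_p)\in\mathbb{F}_p^p$ put $(m_1,\dots,m_p)=(i_1,\dots,i_p)C$. The vector $\mathbf{e}$ satisfies property TF if for every non-zero vector $(i_1,\dots,i_p)\in\mathbb{F}_p^p$ with $i_1+\cdots+i_p=0$ there exists $j\in\{1,\dots,p\}$ such that $m_ji_j\neq 0$. *)

(* Defs.v *)
From HB Require Import structures.
From mathcomp Require Import all_boot all_order all_algebra.
From mathcomp Require Import boolp classical_sets.

Set Implicit Arguments.
Unset Strict Implicit.
Unset Printing Implicit Defensive.

Import GRing.Theory.
Local Open Scope ring_scope.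

Section SubgroupsOfGroupTypes.
Local Open Scope group_scope.
Local Open Scope classical_set_scope.
Variable gT : groupType.

Definition subgroup_generated (S : set gT) : set gT :=
  smallest (fun H : set gT => group_closed [in H]) S.

Definition derived_subgroup (G : set gT) : set gT :=
  subgroup_generated [set [~ x, y] | x in G & y in G].

Definition torsion_free (G : set gT) : Prop :=
  forall (x : gT) (n : nat), G x -> (0 < n)%N -> x ^+ n = 1 -> x = 1.

End SubgroupsOfGroupTypes.

(* The alphabet X = {1, ..., p} is encoded as 'I_p: the letter i of X is the
   ordinal of value i - 1. *)
Notation word p := (seq 'I_p).

Definition adjacent (p : nat) (u v : word p) : bool :=
  [exists x : 'I_p, (v == rcons u x) || (u == rcons v x)].

Record tree_aut (p : nat) := TreeAut {
  tree_fun :> word p -> word p;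
  tree_fun_bij : bijective tree_fun;
  tree_fun_root : tree_fun [::] = [::];
  tree_fun_adj : {mono tree_fun : u v / adjacent u v}
}.

Lemma tree_autP (p : nat) (g h : tree_aut p) : g =1 h -> g = h.
Proof.
case: g h => [g gb gr ga] [h hb hr ha] /= /funext gh; subst h.
by congr TreeAut; apply: Prop_irrelevance.
Qed.

Section TreeAutGroup.
Variable p : nat.
Implicit Types g h : tree_aut p.

HB.instance Definition _ := gen_eqMixin (tree_aut p).
HB.instance Definition _ := gen_choiceMixin (tree_aut p).

Definition tree_one : tree_aut p.
Proof. by exists id => //; exists id. Defined.

Definition tree_mul g h : tree_aut p.
Proof.
exists (g \o h).
- exact: bij_comp (tree_fun_bij g) (tree_fun_bij h).
- by rewrite /= !tree_fun_root.
- by move=> u v /=; rewrite !tree_fun_adj.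
Defined.

Lemma tree_fun_inj g : injective g.
Proof. exact: bij_inj (tree_fun_bij g). Qed.

Lemma tree_fun_surj g (v : word p) : exists u, g u == v.
Proof. by have [f _ fK] := tree_fun_bij g; exists (f v); rewrite fK. Qed.

Definition tree_inv_fun g (v : word p) : word p := xchoose (tree_fun_surj g v).

Lemma tree_inv_funK g : cancel (tree_inv_fun g) g.
Proof. by move=> v; apply/eqP; exact: (xchooseP (tree_fun_surj g v)). Qed.

Lemma tree_funK g : cancel g (tree_inv_fun g).
Proof. by move=> v; apply: (@tree_fun_inj g); rewrite tree_inv_funK. Qed.

Definition tree_inv g : tree_aut p.
Proof.
exists (tree_inv_fun g).
- by exists g; [exact: tree_inv_funK | exact: tree_funK].
- by rewrite -[X in tree_inv_fun g X](tree_fun_root g) tree_funK.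
- by move=> u v; rewrite -(tree_fun_adj g) !tree_inv_funK.
Defined.

Fact tree_mulA : associative tree_mul.
Proof. by move=> f g h; apply: tree_autP. Qed.
Fact tree_1mul : left_id tree_one tree_mul.
Proof. by move=> g; apply: tree_autP. Qed.
Fact tree_mul1 : right_id tree_one tree_mul.
Proof. by move=> g; apply: tree_autP. Qed.
Fact tree_Vmul : left_inverse tree_one tree_inv tree_mul.
Proof. by move=> g; apply: tree_autP => v /=; rewrite tree_funK. Qed.
Fact tree_mulV : right_inverse tree_one tree_inv tree_mul.
Proof. by move=> g; apply: tree_autP => v /=; rewrite tree_inv_funK. Qed.

HB.instance Definition _ := isGroup.Build (tree_aut p)
  tree_mulA tree_1mul tree_mul1 tree_Vmul tree_mulV.

End TreeAutGroup.

Lemma adjacent_nill (p : nat) (x : 'I_p) (v : word p) :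
  adjacent [::] (x :: v) = (v == [::]).
Proof.
apply/existsP/eqP => [[y] | ->]; last by exists x; rewrite eqxx.
by rewrite orbF eqseq_cons => /andP[_ /eqP].
Qed.

Lemma adjacentC (p : nat) (u v : word p) : adjacent u v = adjacent v u.
Proof. by apply: eq_existsb => x; rewrite orbC. Qed.

Lemma adjacent_cons (p : nat) (x y : 'I_p) (u v : word p) :
  adjacent (x :: u) (y :: v) = (x == y) && adjacent u v.
Proof.
apply/existsP/andP => [[z] | [/eqP-> /existsP[z zP]]]; last first.
  by exists z; rewrite !rcons_cons !eqseq_cons eqxx.
rewrite !rcons_cons !eqseq_cons => zP; split.
  by case/orP: zP => /andP[/eqP-> _].
by apply/existsP; exists z; case/orP: zP => /andP[_ ->]; rewrite ?orbT.
Qed.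

Lemma tree_fun_eq0 (p : nat) (g : tree_aut p) (w : word p) :
  (g w == [::]) = (w == [::]).
Proof. by rewrite -{1}(tree_fun_root g) (inj_eq (@tree_fun_inj _ g)). Qed.

Section GGSGroup.
Variable p : nat.
Local Open Scope group_scope.

(* ordS is the p-cycle i |-> i + 1 mod p. *)
Definition rot_fun (v : word p) : word p :=
  if v is x :: w then ordS x :: w else [::].

Definition rot_aut : tree_aut p.
Proof.
exists rot_fun => //.
- exists (fun v => if v is x :: w then ord_pred x :: w else [::]).
  + by case=> //= x w; rewrite ordSK.
  + by case=> //= x w; rewrite ord_predK.
- move=> [|x u] [|y v] //=; rewrite ?[adjacent (_ :: _) [::]]adjacentC.
  + by rewrite !adjacent_nill.
  + by rewrite !adjacent_nill.
  + by rewrite !adjacent_cons (inj_eq (can_inj (@ordSK _))).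
Defined.

Variable e : 'rV['F_p]_p.-1.

(* The section at a letter of value x < p - 1 is a ^ e_(x + 1), and e_(x + 1)
   is the entry of e at the ordinal of value x; the section at the last letter
   is b itself.  As a has order p, the exponent may be read in nat. *)
Fixpoint dir_fun (v : word p) : word p :=
  if v is x :: w then
    x :: (if insub (val x) is Some j then (rot_aut ^+ (e 0%R j : nat)) w
          else dir_fun w)
  else [::].

Fixpoint dir_inv_fun (v : word p) : word p :=
  if v is x :: w then
    x :: (if insub (val x) is Some j then (rot_aut ^- (e 0%R j : nat)) w
          else dir_inv_fun w)
  else [::].

Definition dir_aut : tree_aut p.
Proof.
exists dir_fun => //.
- exists dir_inv_fun; elim=> //= x w IHw; case: insubP => [j _ _|_];
    by rewrite ?IHw ?[LHS]/= ?tree_funK ?tree_inv_funK.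
- have f0 v : (dir_fun v == [::]) = (v == [::]) by case: v.
  elim=> [|x u IHu] [|y v] //=; rewrite ?[adjacent (_ :: _) [::]]adjacentC.
  + by rewrite !adjacent_nill; case: insubP => *; rewrite ?tree_fun_eq0 ?f0.
  + by rewrite !adjacent_nill; case: insubP => *; rewrite ?tree_fun_eq0 ?f0.
  + rewrite !adjacent_cons; case: eqVneq => //= ->.
    by case: insubP => *; rewrite ?tree_fun_adj ?IHu.
Defined.

Definition GGS_group : set (tree_aut p) :=
  subgroup_generated [set rot_aut; dir_aut]%classic.

End GGSGroup.

(* With 0-based indices, the entry in position (i, j) off the diagonal is e_k,
   where 1 <= k < p and k = j - i mod p. *)
Definition circulant (p : nat) (e : 'rV['F_p]_p.-1) : 'M['F_p]_p :=
  \matrix_(i, j) if i == j then 0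
                 else oapp (e 0) 0 (insub ((j + p - i) %% p).-1%N).

Definition property_TF (p : nat) (e : 'rV['F_p]_p.-1) : Prop :=
  forall i : 'rV['F_p]_p, i != 0 -> \sum_j i 0 j = 0 ->
    exists j : 'I_p, (i *m circulant e) 0 j * i 0 j != 0.

(* Main.v *)
(** The letters are identified with F_p, so that a acts on them as z |-> z + 1,
    and e with a function E on F_p such that E 0 = 0 ([kernel] below). Every g
    in G carries an exponent pair (m, s), "g = a^m b^s modulo G'". There is a
    function i on F_p with sum s such that the section of g at z carries the
    pair ((i * E) z, i z), where the convolution i * E is i times the circulant
    matrix. By TF a vector i with i * E = 0 is equal to its cyclic shift, so it
    is constant and has sum 0; this gives uniqueness of exponent pairs.

    If both exponents of g are nonzero, then each section of g^p has the same
    nonzero b-exponent as g, so that g^p != 1. Hence if g has exponents (0, 0)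
    and g^p = 1, TF forces i = 0: all sections of g satisfy the same hypotheses,
    and by descent g = 1. The same descent, with uniqueness of exponents alone,
    excludes torsion prime to p. *)
Require Import Defs.
From mathcomp Require Import all_boot all_order all_algebra.
From mathcomp Require Import boolp classical_sets.
From mathcomp Require Import ring.

Set Implicit Arguments.
Unset Strict Implicit.
Unset Printing Implicit Defensive.

Import GRing.Theory.
Local Open Scope ring_scope.

(** * Letters of the tree as elements of F_p *)

Section PrimeFieldLetters.
Variables (p : nat) (p_prime : prime p).

Definition digit (x : 'I_p) : 'F_p := (x : nat)%:R.

Lemma ltn_Fp (z : 'F_p) : (z < p)%N.
Proof. by have := ltn_ord z; rewrite [X in (_ < X)%N -> _]Fp_cast. Qed.

Definition letter (z : 'F_p) : 'I_p := Ordinal (ltn_Fp z).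

Lemma val_digit x : digit x = x :> nat.
Proof. by rewrite /digit val_Fp_nat // modn_small. Qed.

Lemma digitK : cancel digit letter.
Proof. by move=> x; apply: val_inj; exact: val_digit. Qed.

Lemma letterK : cancel letter digit.
Proof. by move=> z; apply: val_inj; exact: val_digit. Qed.

Lemma letter_inj : injective letter.
Proof. exact: can_inj letterK. Qed.

Lemma natFp_p : p%:R = 0 :> 'F_p.
Proof. by apply: val_inj; rewrite /= val_Fp_nat // modnn. Qed.

Lemma natFp_neq0 n : (n%:R != 0 :> 'F_p) = ~~ (p %| n)%N.
Proof. by rewrite -(inj_eq val_inj) /= val_Fp_nat. Qed.

Lemma natFp_mod n : (n %% p)%:R = n%:R :> 'F_p.
Proof. by apply: val_inj; rewrite /= !val_Fp_nat // modn_mod. Qed.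

Lemma ordS_letter z : ordS (letter z) = letter (z + 1).
Proof.
apply: (can_inj digitK); rewrite letterK /digit /= natFp_mod -natr1.
by congr (_ + _); apply: (letterK z).
Qed.

(** As [m] is invertible, the progression visits each element of F_p exactly once. *)
Lemma sum_arith (i : 'F_p -> 'F_p) z m : m != 0 ->
  \sum_(k < p) i (z + k%:R * m) = \sum_u i u.
Proof.
move=> m0; rewrite [RHS](reindex (fun k : 'I_p => z + digit k * m)) //.
exists (fun u => letter ((u - z) / m)) => [k|u] _.
  by rewrite addrC addKr mulfK // digitK.
by rewrite letterK divfK // addrC subrK.
Qed.

End PrimeFieldLetters.

Section GGS.
Variables (p : nat) (p_prime : prime p) (e : 'rV['F_p]_p.-1).
Implicit Types (g h : tree_aut p) (m s z : 'F_p) (i : 'F_p -> 'F_p).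
Local Notation letter := (letter p_prime).

(** The value at 0 is the zero diagonal of the circulant. For other [z], [.-1] turns the 1-based
    index of [e] into an ordinal, and the default 0 of [oapp] is never reached. *)
Definition kernel z : 'F_p :=
  if z == 0 then 0 else oapp (e 0) 0 (insub (z : nat).-1).

Definition conv i z : 'F_p := \sum_u i u * kernel (z - u).

Lemma conv_shift i m z : conv (fun u => i (u + m)) z = conv i (z + m).
Proof.
rewrite /conv [RHS](reindex_inj (addIr m)); apply: eq_bigr => u _.
by rewrite opprD addrACA subrr addr0.
Qed.

Lemma convD i j z : conv (fun u => i u + j u) z = conv i z + conv j z.
Proof. by rewrite -big_split; apply: eq_bigr => u _; rewrite mulrDl. Qed.

Lemma convN i z : conv (fun u => - i u) z = - conv i z.
Proof. by rewrite -sumrN; apply: eq_bigr => u _; rewrite mulNr. Qed.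

Lemma conv_const0 i z : (forall u, i u = 0) -> conv i z = 0.
Proof. by move=> i0; rewrite /conv big1 // => u _; rewrite i0 mul0r. Qed.

Lemma circulantE x y : circulant e x y = kernel (digit y - digit x).
Proof.
rewrite mxE /kernel subr_eq0 (can_eq (digitK p_prime)) eq_sym.
case: eqP => // _; congr (oapp _ _ (insub _.-1)).
have le_xp : (x <= y + p)%N by rewrite (leq_trans (ltnW (ltn_ord x))) ?leq_addl.
rewrite -(val_Fp_nat p_prime); congr (nat_of_ord _).
by rewrite natrB // natrD natFp_p // addr0.
Qed.

Lemma TF_conv i : property_TF e -> \sum_z i z = 0 ->
  (forall z, conv i z * i z = 0) -> forall z, i z = 0.
Proof.
move=> TF sum0 orth.
have sumE (F : 'F_p -> 'F_p) : \sum_z F z = \sum_x F (digit x).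
  apply: reindex; exists letter => x _; first exact: digitK.
  exact: letterK.
pose v : 'rV['F_p]_p := \row_x i (digit x).
suff v0 : v = 0.
  by move=> z; have := congr1 (fun w : 'rV_p => w 0 (letter z)) v0;
    rewrite !mxE letterK.
apply/eqP/negPn/negP => v0; case: (TF v v0) => [|x].
  by rewrite (eq_bigr _ (fun x _ => mxE _ _ _ _)) -sumE.
case/negP; rewrite -(orth (digit x)) /conv sumE !mxE; apply/eqP.
by congr (_ * _); apply: eq_bigr => y _; rewrite mxE circulantE.
Qed.

(** A relation, not a function: it records exponent sums along a word in the generators, and
    different words for one element might a priori give different pairs. *)
Inductive exponents : tree_aut p -> 'F_p -> 'F_p -> Prop :=
| exponents_rot : exponents (rot_aut p) 1 0
| exponents_dir : exponents (dir_aut e) 0 1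
| exponents1 : exponents 1%g 0 0
| exponentsM g h m n s t : exponents g m s -> exponents h n t ->
    exponents (g * h)%g (m + n) (s + t)
| exponentsV g m s : exponents g m s -> exponents g^-1%g (- m) (- s).

Lemma exponentsX g m s n : exponents g m s ->
  exponents (g ^+ n)%g (n%:R * m) (n%:R * s).
Proof.
move=> gE; elim: n => [|n IH]; first by rewrite !mul0r; exact: exponents1.
by rewrite expgS -!nat1r !mulrDl !mul1r; apply: exponentsM.
Qed.

(** * Exponent pairs of sections *)

Lemma eqN1_letter z : (z == -1) = ~~ (letter z < p.-1)%N.
Proof.
have p_gt0 := prime_gt0 p_prime.
rewrite -subr_eq0 opprK -[z in LHS](letterK p_prime) /digit natr1.
apply: negb_inj; rewrite natFp_neq0 // negbK ltn_predRL.
have [lt_zp|le_pz] := ltnP; first by rewrite gtnNdvd.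
have -> : (letter z).+1 = p by apply/eqP; rewrite eqn_leq le_pz ltn_ord.
by rewrite dvdnn.
Qed.

Lemma kernel_succ z : kernel (z + 1) =
  oapp (e 0) 0 (insub (letter z : nat)).
Proof.
rewrite /kernel addr_eq0 eqN1_letter.
case: (insubP _ (letter z : nat)) => [k lt_zp zk|/negPf->] //.
suff -> : ((z + 1)%R : nat).-1 = k by rewrite lt_zp valK.
rewrite zk -[z in LHS](letterK p_prime) /digit natr1 val_Fp_nat //.
by rewrite modn_small // -ltn_predRL.
Qed.

Lemma exponents_sections g m s : exponents g m s ->
  exists (i : 'F_p -> 'F_p) (f : 'F_p -> tree_aut p),
  [/\ \sum_z i z = s,
      forall z w, g (letter z :: w) = letter (z + m) :: f z w
    & forall z, exponents (f z) (conv i z) (i z)].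
Proof.
elim=> {g m s} [|||g h m n s t _ [i [f [si gf fE]]] _ [j [k [sj hk kE]]]
               |g m s _ [i [f [si gf fE]]]].
- exists (fun=> 0), (fun=> 1%g); split=> [|z w|z]; first by rewrite big1.
    by rewrite /= ordS_letter.
  by rewrite conv_const0 //; exact: exponents1.
(* -1 is the last letter, where the section of b is b; elsewhere it is a power of a. *)
- exists (fun z => (z == -1)%:R).
  exists (fun z => if insub (letter z : nat) is Some k
                   then (rot_aut p ^+ (e 0 k : nat))%g else dir_aut e).
  split=> [|z w|z].
  + by rewrite (bigD1 (-1)) //= eqxx big1 ?addr0 // => z /negPf->.
  + by rewrite addr0 /=; case: insubP.
  + have -> : conv (fun u => (u == -1)%:R) z = kernel (z + 1).
      rewrite /conv (bigD1 (-1)) //= eqxx mul1r big1 ?addr0 ?opprK //.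
      by move=> u /negPf->; rewrite mul0r.
    rewrite kernel_succ eqN1_letter; case: insubP => [k -> _|->] /=.
      by have := exponentsX (e 0 k) exponents_rot; rewrite mulr0 mulr1 natr_Zp.
    exact: exponents_dir.
- exists (fun=> 0), (fun=> 1%g); split=> [|z w|z]; first by rewrite big1.
    by rewrite addr0.
  by rewrite conv_const0 //; exact: exponents1.
(* [h] acts first and moves [z] to [z + n], where the section of [g] is taken. *)
- exists (fun z => i (z + n) + j z), (fun z => f (z + n) * k z)%g.
  split=> [|z w|z].
  + by rewrite big_split /= -si -sj [in RHS](reindex_inj (addIr n)).
  + by rewrite /= hk gf addrAC addrA.
  + by rewrite convD conv_shift; exact: exponentsM.
- exists (fun z => - i (z - m)), (fun z => (f (z - m))^-1)%g.
  split=> [|z w|z].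
  + by rewrite sumrN -si [in RHS](reindex_inj (addIr (- m))).
  + by apply: (@tree_fun_inj _ g); rewrite gf /= !tree_inv_funK subrK.
  + by rewrite convN conv_shift; exact: exponentsV.
Qed.

(** * Uniqueness of exponent pairs *)

Hypothesis e_TF : property_TF e.

Lemma exponents_one m s : exponents 1%g m s -> m = 0 /\ s = 0.
Proof.
(* The exponent of a is visible in the action on the first level. *)
have level1 n t : exponents 1%g n t -> n = 0.
  case/exponents_sections=> i [f [_ gf _]].
  by have /(congr1 (head (letter 0)))/letter_inj := gf 0 [::]; rewrite add0r.
move=> oneE; have m0 := level1 _ _ oneE; split=> //.
have [i [f [si gf fE]]] := exponents_sections oneE.
have conv0 z : conv i z = 0.
  apply: level1 (_ : exponents 1%g _ (i z)).
  suff <- : f z = 1%g by [].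
  by apply: tree_autP => w; have /(congr1 behead) := gf z w.
have shiftE z : i (z + 1) = i z.
  apply/eqP; rewrite -subr_eq0; apply/eqP; move: z.
  (* The difference with the shift has sum 0, and its convolution vanishes with that of [i]. *)
  apply: (TF_conv (i := fun z => i (z + 1) - i z)) => // [|z].
    by rewrite sumrB [X in _ - X](reindex_inj (addIr 1)) subrr.
  by rewrite convD convN conv_shift !conv0 subrr mul0r.
have constE z : i z = i 0.
  rewrite -(natr_Zp z); elim: (z : nat) => // n IH.
  by rewrite -natr1 shiftE.
rewrite -si (eq_bigr _ (fun z _ => constE z)) sumr_const card_Fp //.
by rewrite -mulr_natr natFp_p // mulr0.
Qed.

(** * Torsion and descent to sections *)

Lemma exponents_expp g m s : exponents g m s -> m != 0 -> (g ^+ p)%g = 1%g ->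
  s = 0.
Proof.
move=> gE m0 gp1; have [i [f [si gf fE]]] := exponents_sections gE.
(* [h] is the section of [g ^+ n] at [letter 0]; its b-exponent adds up [i] along the orbit. *)
have powE n : exists h, (forall w,
    (g ^+ n)%g (letter 0 :: w) = letter (0 + n%:R * m) :: h w) /\
    exists t, exponents h t (\sum_(k < n) i (0 + k%:R * m)).
  elim: n => [|n [h [hgn [t hE]]]].
    exists 1%g; split=> [w|]; first by rewrite mul0r addr0.
    by exists 0; rewrite big_ord0; exact: exponents1.
  exists (f (0 + n%:R * m) * h)%g; split=> [w|].
    by rewrite expgS /= hgn gf -natr1 mulrDl mul1r addrA.
  exists (conv i (0 + n%:R * m) + t); rewrite big_ord_recr /= addrC.
  exact: exponentsM.
(* As [m != 0], the orbit meets every letter once, so the sum is [s]. *)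
have [h [hgp [t]]] := powE p; rewrite sum_arith // si; have -> : h = 1%g.
  by apply: tree_autP => w; have /(congr1 behead) := hgp w; rewrite gp1.
by case/exponents_one.
Qed.

(* [Q] plays the role of a bisimulation with the identity. *)
Lemma tree_aut1_ind (Q : tree_aut p -> Prop) :
  (forall g, Q g -> exists f : 'F_p -> tree_aut p,
     forall z, Q (f z) /\ forall w, g (letter z :: w) = letter z :: f z w) ->
  forall g, Q g -> g = 1%g.
Proof.
move=> step g Qg; apply: tree_autP => w.
elim: w g Qg => [|x w IH] g Qg; first exact: tree_fun_root.
have [f /(_ (digit x))[Qf]] := step g Qg.
by rewrite digitK => ->; rewrite IH.
Qed.

Lemma section_expg g h n z :
  (forall w, g (letter z :: w) = letter z :: h w) ->
  (g ^+ n)%g = 1%g -> (h ^+ n)%g = 1%g.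
Proof.
move=> gh gn1; apply: tree_autP => w.
suff /(congr1 behead) :
    (g ^+ n)%g (letter z :: w) = letter z :: (h ^+ n)%g w.
  by rewrite gn1.
by elim: n {gn1} => // n IH; rewrite !expgS /= IH gh.
Qed.

Lemma exponents_coprime_torsion g n m s : ~~ (p %| n)%N -> exponents g m s ->
  (g ^+ n)%g = 1%g -> g = 1%g.
Proof.
rewrite -(natFp_neq0 p_prime) => n0 gE gn1.
(* The pair is left arbitrary, since sections need not inherit a prescribed one. *)
apply: (tree_aut1_ind (Q := fun h =>
  (exists m s, exponents h m s) /\ (h ^+ n)%g = 1%g)); last first.
  by split=> //; exists m, s.
move=> {g m s gE gn1} g [[m [s gE]] gn1].
have [i [f [_ gf fE]]] := exponents_sections gE.
have m0 : m = 0.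
  have := exponentsX n gE; rewrite gn1 => /exponents_one[/eqP + _].
  by rewrite mulf_eq0 (negPf n0) => /eqP.
move: gf; rewrite m0 => gf; exists f => z.
have gfz w : g (letter z :: w) = letter z :: f z w by rewrite gf addr0.
split=> //; split; first by exists (conv i z), (i z).
exact: section_expg gfz gn1.
Qed.

Lemma exponents_p_torsion g : exponents g 0 0 -> (g ^+ p)%g = 1%g -> g = 1%g.
Proof.
move=> gE gp1; apply: (tree_aut1_ind (Q := fun h =>
  exponents h 0 0 /\ (h ^+ p)%g = 1%g)) => // {gE gp1}g [gE gp1].
have [i [f [si gf fE]]] := exponents_sections gE.
have gfz z w : g (letter z :: w) = letter z :: f z w by rewrite gf addr0.
have fp1 z : (f z ^+ p)%g = 1%g := section_expg (gfz z) gp1.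
have i0 : forall z, i z = 0.
  apply: TF_conv => // z; have [->|cz] := eqVneq (conv i z) 0.
    by rewrite mul0r.
  by rewrite (exponents_expp (fE z) cz (fp1 z)) mulr0.
exists f => z; split=> //; split=> //.
by have := fE z; rewrite i0 conv_const0.
Qed.

Lemma exponents_torsion_free : torsion_free [set g | exponents g 0 0]%classic.
Proof.
move=> g n /= gE; elim/ltn_ind: n => n IH n_gt0 gn1.
have [/dvdnP[k nE]|pn] := boolP (p %| n)%N; last first.
  exact: exponents_coprime_torsion pn gE gn1.
move: n_gt0 gn1 IH; rewrite {}nE muln_gt0 => /andP[k_gt0 _] gn1 IH.
(* [g ^+ k] has trivial p-th power, hence is trivial, and [k] is a smaller exponent. *)
apply: (IH k) => //; first by rewrite ltn_Pmulr ?prime_gt1.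
apply: exponents_p_torsion; last by rewrite -expgnA.
by have := exponentsX k gE; rewrite mulr0.
Qed.

(** * Exponents on G and on its derived subgroup *)

Lemma GGS_exponents g : GGS_group e g -> exists m s, exponents g m s.
Proof.
apply: (@smallest_sub _ _ _ [set g | exists m s, exponents g m s]%classic).
  split=> [|x y /set_mem[m [s xE]] /set_mem[n [t yE]]]; apply/mem_set.
    by exists 0, 0; exact: exponents1.
  by exists (m - n), (s - t); apply/exponentsM/exponentsV.
by move=> _ [->|->]; [exists 1, 0 | exists 0, 1]; constructor.
Qed.

Lemma derived_exponents g : derived_subgroup (GGS_group e) g ->
  exponents g 0 0.
Proof.
apply: (@smallest_sub _ _ _ [set g | exponents g 0 0]%classic).
  split=> [|x y /set_mem xE /set_mem yE]; apply/mem_set; first exact: exponents1.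
  by have := exponentsM xE (exponentsV yE); rewrite oppr0 addr0.
move=> _ [x /GGS_exponents[m [s xE]] [y /GGS_exponents[n [t yE]] <-]] /=.
have := exponentsM (exponentsV xE) (exponentsM (exponentsV yE)
  (exponentsM xE yE)).
by rewrite commgEl conjgE; congr exponents; ring.
Qed.

End GGS.

Theorem theorem4p5 (p : nat) (p_prime : prime p) (p_odd : odd p)
    (e : 'rV['F_p]_p.-1) (e_neq0 : e != 0) (e_TF : property_TF e) :
  torsion_free (derived_subgroup (GGS_group e)).
Proof.
move=> g n /derived_exponents gE.
exact: (exponents_torsion_free p_prime e_TF gE).
Qed.
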